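(* Let $\tau>0$, $M\in{\rm Sp}(2n,\mathbb{R})$ orthogonal symplectic, $\Lambda\subset\mathbb{R}$ an open interval, and $H:\Lambda\times\mathbb{R}^{2n}\to\mathbb{R}$ continuous with each $H_\lambda$ $M$-invariant, $C^2$, and all partial derivatives continuous in $\lambda$. Let $v_0:\mathbb{R}\to\mathbb{R}^{2n}$ be a nonconstant solution of $$\dot v(t)=J\nabla H_\lambda(v(t)),\quad v(t+\tau)=Mv(t)\ \forall t\in\mathbb{R}\qquad(\ast)$$ for each $\lambda\in\Lambda$. Suppose that for some $\mu\in\Lambda$ there exist $\lambda_k\in\Lambda$, $\lambda_k\to\mu$, and solutions $v_k$ of $(\ast)$ with $\lambda=\lambda_k$, pairwise $\mathbb{R}$-distinct, such that $v_k|_{[0,\tau]}\to v_0|_{[0,\tau]}$ in $W^{1,2}([0,\tau];\mathbb{R}^{2n})$. Then the problem $\dot v(t)=JH''_\mu(v_0(t))v(t)$, $v(t+\tau)=Mv(t)$ $\forall t$, has at least two linearly independent nontrivial solutions, i.e. $\dim{\rm Ker}(\gamma_\mu(\tau)-M)\ge2$, where $\gamma_\lambda$ is the fundamental matrix solution of $\dot Z=JH''_\lambda(v_0(t))Z$, $Z(0)=I_{2n}$.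
   Context: $J=\begin{pmatrix}0&-I_n\\ I_n&0\end{pmatrix}$; ${\rm Sp}(2n,\mathbb{R})=\{M:M^TJM=J\}$; $H_\lambda=H(\lambda,\cdot)$, $M$-invariant meaning $H_\lambda(Mz)=H_\lambda(z)$. Two solutions are $\mathbb{R}$-distinct if they do not lie in the same orbit $\{v(\theta+\cdot):\theta\in\mathbb{R}\}$.
   Formalization: ''All partial derivatives continuous in λ'' is taken as joint continuity of the first and second partial derivatives in (λ,z) on Λ×R^{2n}; with continuity in λ only at each fixed z the claim fails. *)

(* Defs.v *)
From HB Require Import structures.
From mathcomp Require Import all_boot all_order all_algebra.
From mathcomp Require Import all_classical all_reals all_analysis.
Set Implicit Arguments. Unset Strict Implicit. Unset Printing Implicit Defensive.
Import Order.TTheory GRing.Theory Num.Theory.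
Import numFieldNormedType.Exports.
Local Open Scope classical_set_scope.
Local Open Scope ring_scope.

Section Defs.
Variables (R : realType) (n : nat).

Definition Jmat : 'M[R]_(n + n) := block_mx 0 (- 1%:M) 1%:M 0.

Definition symplectic_mx (M : 'M[R]_(n + n)) : Prop := M^T *m Jmat *m M = Jmat.
Definition orth_mx (M : 'M[R]_(n + n)) : Prop := M^T *m M = 1%:M.

Definition evec (i : 'I_(n + n)) : 'cV[R]_(n + n) := delta_mx i 0.

Definition partial (i : 'I_(n + n)) (f : 'cV[R]_(n + n) -> R) :
  'cV[R]_(n + n) -> R := fun z => 'D_(evec i) f z.

Definition grad (f : 'cV[R]_(n + n) -> R) (z : 'cV[R]_(n + n)) : 'cV[R]_(n + n) :=
  \col_i partial i f z.

Definition hess (f : 'cV[R]_(n + n) -> R) (z : 'cV[R]_(n + n)) : 'M[R]_(n + n) :=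
  \matrix_(i, j) partial j (partial i f) z.

Definition C2 (f : 'cV[R]_(n + n) -> R) : Prop :=
  forall i j : 'I_(n + n),
    (forall z, derivable f z (evec i)) /\
    (forall z, derivable (partial i f) z (evec j)) /\
    continuous (partial i f) /\ continuous (partial j (partial i f)).

Definition is_sol (H : R -> 'cV[R]_(n + n) -> R) (lam tau : R)
  (M : 'M[R]_(n + n)) (v : R -> 'cV[R]_(n + n)) : Prop :=
  (forall t, derivable v t 1 /\ 'D_1 v t = Jmat *m grad (H lam) (v t)) /\
  (forall t, v (t + tau) = M *m v t).

Definition R_distinct (v w : R -> 'cV[R]_(n + n)) : Prop :=
  ~ exists theta : R, forall t, v t = w (theta + t).

Definition sqnorm (x : 'cV[R]_(n + n)) : R := \sum_i (x i 0) ^+ 2.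

Definition W12_dist2 (tau : R) (v w : R -> 'cV[R]_(n + n)) : \bar R :=
  (\int[@lebesgue_measure R]_(t in `[0%R, tau]%classic)
     (sqnorm (v t - w t) + sqnorm ('D_1 v t - 'D_1 w t))%:E)%E.

End Defs.
Arguments Jmat {R n}.

(* Main.v *)
(* Since M is orthogonal, W^{1,2}-convergence on one period gives uniform
   convergence v_k -> v0 on the whole line.  Pick t0 with v0'(t0) <> 0.  By the
   intermediate value theorem, v_k can be shifted in time by theta_k -> 0 so that
   v_k(t0 + theta_k) - v0(t0) is orthogonal to v0'(t0); this difference is nonzero
   except for at most one k, by uniqueness and R-distinctness.  As v0 solves the
   equation for lambda_k too, the normalized differences satisfy
   |d_k' - J H''_mu(v0) d_k| <= e_k |d_k| with e_k -> 0, so by Gronwall's inequality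
   they are locally bounded, and their pointwise limit along an ultrafilter is a
   solution of the linearized problem which at t0 is nonzero and orthogonal to
   v0'(t0).  The same limiting argument applied to difference quotients of v0
   shows that v0' is another solution. *)
Require Import Defs.
From HB Require Import structures.
From mathcomp Require Import all_boot all_order all_algebra.
From mathcomp Require Import all_classical all_reals all_analysis.
From mathcomp Require Import ring lra.
Import Order.TTheory GRing.Theory Num.Theory.
Import numFieldNormedType.Exports.
Local Open Scope classical_set_scope.
Local Open Scope ring_scope.
Set Implicit Arguments. Unset Strict Implicit.

(** * Maximum norm of matrices and mean value theorems *)

Lemma coord_le_norm (R : realType) p q (x : 'M[R]_(p, q)) i j :
  `|x i j| <= `|x|.
Proof.
by rewrite [leRHS]/Num.Def.normr/= mx_normrE; exact: (le_bigmax _ _ (i, j)).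
Qed.

Lemma mx_norm_le (R : realType) p q (x : 'M[R]_(p, q)) (C : R) :
  0 <= C -> (forall i j, `|x i j| <= C) -> `|x| <= C.
Proof.
move=> C0 xC; rewrite [leLHS]/Num.Def.normr/= mx_normrE.
by apply: (bigmax_le _ C0) => -[i j] _; exact: xC.
Qed.

Lemma mulmx_norm_le (R : realType) p q (A : 'M[R]_(p, q)) (x : 'cV[R]_q) :
  `|A *m x| <= q%:R * `|A| * `|x|.
Proof.
apply: mx_norm_le => [|i j]; first by rewrite !mulr_ge0.
rewrite mxE (le_trans (ler_norm_sum _ _ _))//.
rewrite (le_trans (_ : _ <= \sum_(k < q) `|A| * `|x|))//.
  by apply: ler_sum => k _; rewrite normrM ler_pM// coord_le_norm.
by rewrite sumr_const card_ord -[leLHS]mulr_natl mulrA.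
Qed.

Lemma is_derive_coord (R : realType) p q (v : R -> 'M[R]_(p, q)) (t : R) (d : 'M[R]_(p, q)) i j :
  is_derive t (1 : R) v d -> is_derive t (1 : R) (fun s => v s i j) (d i j).
Proof.
move=> [dv <-]; apply: DeriveDef; first exact: (derivable_mxP v t 1).1.
by rewrite derive_mx// mxE.
Qed.

Lemma is_derive_mx (R : realType) p q (v : R -> 'M[R]_(p, q)) (t : R) (d : 'M[R]_(p, q)) :
  (forall i j, is_derive t (1 : R) (fun s => v s i j) (d i j)) ->
  is_derive t (1 : R) v d.
Proof.
move=> dv; have vt : derivable v t 1.
  by apply/derivable_mxP => i j; have [] := dv i j.
apply: DeriveDef => //; rewrite derive_mx//; apply/matrixP => i j.
by rewrite mxE; have [] := dv i j.
Qed.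

Lemma derivable_cont (R : realType) (V : normedModType R) (f : R -> V) (t : R) d :
  is_derive t (1 : R) f d -> {for t, continuous f}.
Proof. by move=> [/derivable1_diffP/differentiable_continuous]. Qed.

(** Locating [c] by its distance to [a] lets [a] and [b] come in either order. *)
Lemma MVT_dist (R : realType) (f df : R -> R) (a b : R) :
  (forall x, is_derive x (1 : R) f (df x)) ->
  exists2 c, `|c - a| <= `|b - a| & f b - f a = df c * (b - a).
Proof.
move=> fdf.
have cf x y : {within `[x, y], continuous f}.
  by apply: continuous_subspaceT => z; apply: derivable_cont (fdf z).
have [ab|/ltW ba] := leP a b.
  have [c] := MVT_segment ab (fun x _ => fdf x) (cf a b).
  rewrite in_itv/= => /andP[ac cb] fc; exists c => //.
  by rewrite !ger0_norm ?subr_ge0// lerB.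
have [c] := MVT_segment ba (fun x _ => fdf x) (cf b a).
rewrite in_itv/= => /andP[bc ca] fc; exists c.
  by rewrite distrC (distrC b) !ger0_norm ?subr_ge0// lerB.
by rewrite -[b - a]opprB mulrN -fc opprB.
Qed.

(** The norm is the maximum of the entries, so the scalar theorem applied entry by entry costs no
    dimensional constant. *)
Lemma mean_value_inequality (R : realType) p q (f df : R -> 'M[R]_(p, q))
    (a b C : R) : 0 <= C ->
  (forall x, is_derive x (1 : R) f (df x)) ->
  (forall x, `|x - a| <= `|b - a| -> `|df x| <= C) ->
  `|f b - f a| <= C * `|b - a|.
Proof.
move=> C0 fdf dfC; apply: mx_norm_le => [|i j]; first by rewrite mulr_ge0.
have [c ca] := MVT_dist a b (fun x => is_derive_coord i j (fdf x)).
rewrite !mxE => ->; rewrite normrM ler_wpM2r//.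
by rewrite (le_trans (coord_le_norm _ _ _))// dfC.
Qed.

Lemma derive_zero_cst (R : realType) p q (f : R -> 'M[R]_(p, q)) :
  (forall x, is_derive x (1 : R) f 0) -> forall s t, f s = f t.
Proof.
move=> f0 s t; apply/eqP; rewrite -subr_eq0 -normr_le0.
have := @mean_value_inequality _ _ _ f (fun=> 0) t s 0 (lexx _) f0.
by rewrite mul0r; apply=> x _; rewrite normr0.
Qed.

Lemma derivable_line (R : realType) (V : normedModType R) (f : V -> R) (p e : V) s :
  derivable f (p + s *: e) e ->
  is_derive s (1 : R) (fun r : R => f (p + r *: e)) ('D_e f (p + s *: e)).
Proof.
move=> df.
have E : (fun h : R => h^-1 *: ((((fun r : R => f (p + r *: e)) \o shift s) (h *: 1)) - f (p + s *: e)))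
  = (fun h => h^-1 *: ((f \o shift (p + s *: e)) (h *: e) - f (p + s *: e))).
  apply/funext => h /=; congr (_ *: (f _ - _)).
  by rewrite [h%:A]mulr1 scalerDl addrCA.
by apply: DeriveDef; rewrite /derivable /derive E.
Qed.

(** Only partial derivatives are at hand, so [y] is moved to [z] one coordinate at a time. Each step
    is a scalar mean value theorem, which is why the points [xi j] depend on [j]. *)
Lemma multivariate_mean_value (R : realType) m (f : 'cV[R]_m -> R)
    (y z : 'cV[R]_m) :
  (forall (j : 'I_m) x, derivable f x (delta_mx j 0)) ->
  exists xi : 'I_m -> 'cV[R]_m, (forall j, `|xi j - y| <= `|z - y|) /\
    f z - f y = \sum_j 'D_(delta_mx j 0) f (xi j) * (z - y) j 0.
Proof.
move=> df.
(* Corners of the staircase path: the first [k] coordinates are those of [z], the others those of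
   [y]. *)
pose p k : 'cV[R]_m := \col_i (if (i < k)%N then z i 0 else y i 0).
have p0 : p 0%N = y by apply/matrixP => i j; rewrite mxE ltn0 ord1.
have pm : p m = z by apply/matrixP => i j; rewrite mxE ltn_ord ord1.
have pS (j : 'I_m) : p j.+1 = p j + (z - y) j 0 *: delta_mx j 0.
  apply/matrixP => i k; rewrite ord1 !mxE ltnS leq_eqVlt -val_eqE/=.
  case: ltngtP => //=; rewrite ?mulr0 ?addr0 // => /val_inj ->.
  by rewrite mulr1 addrC subrK.
have H (j : 'I_m) : exists x, `|x - y| <= `|z - y| /\
    f (p j.+1) - f (p j) = 'D_(delta_mx j 0) f x * (z - y) j 0.
  have [c] := MVT_dist 0 ((z - y) j 0) (fun s => derivable_line (df j (p j + s *: delta_mx j 0))).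
  rewrite !subr0 => cz E; exists (p j + c *: delta_mx j 0); split; last first.
    by rewrite pS -E scale0r addr0.
  apply: mx_norm_le => // i k; rewrite ord1 !mxE -val_eqE/=.
  case: ltngtP => [ij|ij|/val_inj ->] /=; rewrite ?mulr0 ?addr0.
  - by have := coord_le_norm (z - y) i 0; rewrite !mxE.
  - by rewrite subrr normr0.
  - by rewrite mulr1 addrAC subrr add0r (le_trans cz)// coord_le_norm.
have [xi xiP] := choice H; exists xi; split=> [j|]; first by case: (xiP j).
rewrite -pm -[in f y]p0 -(telescope_sumr (fun k => f (p k)))// big_mkord pm.
by apply: eq_bigr => j _; case: (xiP j).
Qed.

(** * The squared Euclidean norm, which unlike the maximum norm is differentiable *)

Lemma sqnorm_ge0 (R : realType) n (x : 'cV[R]_(n + n)) : 0 <= sqnorm x.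
Proof. by apply: sumr_ge0 => i _; rewrite sqr_ge0. Qed.

Lemma norm_sqr_le_sqnorm (R : realType) n (x : 'cV[R]_(n + n)) :
  `|x| ^+ 2 <= sqnorm x.
Proof.
rewrite -[leRHS]sqr_sqrtr ?sqnorm_ge0// lerXn2r// ?nnegrE ?sqrtr_ge0//.
apply: mx_norm_le => [|i j]; first exact: sqrtr_ge0.
rewrite ord1 -sqrtr_sqr ler_sqrt ?sqr_ge0// ?sqnorm_ge0//.
by rewrite /sqnorm (bigD1 i)//= lerDl sumr_ge0// => k _; exact: sqr_ge0.
Qed.

Lemma sqnorm_le_norm (R : realType) n (x : 'cV[R]_(n + n)) :
  sqnorm x <= (n + n)%:R * `|x| ^+ 2.
Proof.
rewrite /sqnorm (le_trans (_ : _ <= \sum_(i < n + n) `|x| ^+ 2))//.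
  apply: ler_sum => i _; rewrite -[leLHS]real_normK ?num_real//.
  by rewrite lerXn2r ?nnegrE// coord_le_norm.
by rewrite sumr_const card_ord mulr_natl.
Qed.

Lemma sqnorm_eq0 (R : realType) n (x : 'cV[R]_(n + n)) : sqnorm x <= 0 -> x = 0.
Proof.
move=> x0; apply/eqP; rewrite -normr_eq0 -sqrf_eq0 eq_le sqr_ge0 andbT.
exact: le_trans (norm_sqr_le_sqnorm _) x0.
Qed.

Lemma is_derive_sqnorm (R : realType) n (v : R -> 'cV[R]_(n + n)) (t : R) (d : 'cV[R]_(n + n)) :
  is_derive t (1 : R) v d ->
  is_derive t (1 : R) (fun s => sqnorm (v s)) (2 * \sum_i v t i 0 * d i 0).
Proof.
move=> vd.
have -> : (fun s => sqnorm (v s)) = \sum_(i < n + n) (fun s => v s i 0 ^+ 2).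
  by apply/funext => s; rewrite fct_sumE.
rewrite mulr_sumr; apply: is_derive_sum => i.
have := is_derive_coord i 0 vd => vid.
have := @is_deriveX _ _ (fun s => v s i 0) 2 t 1 _ vid.
rewrite exprfctE/= => H. apply: (is_derive_eq H).
by rewrite expr1 mulrA.
Qed.

Lemma orth_sqnorm (R : realType) n (M : 'M[R]_(n + n)) x :
  orth_mx M -> sqnorm (M *m x) = sqnorm x.
Proof.
move=> MM.
have E (y : 'cV[R]_(n + n)) : sqnorm y = (y^T *m y) 0 0.
  by rewrite /sqnorm mxE; apply: eq_bigr => i _; rewrite mxE expr2.
by rewrite !E trmx_mul mulmxA -(mulmxA _ M^T) MM mulmx1.
Qed.

(** * Gronwall estimates and periodicity *)

Lemma gronwall_growth (R : realType) (q dq : R -> R) (B : R) :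
  (forall x, is_derive x (1 : R) q (dq x)) -> (forall x, `|dq x| <= B * q x) ->
  forall t0 t, q t <= q t0 * expR (B * `|t - t0|).
Proof.
move=> qdq dqB t0 t.
have [->|tt0] := eqVneq t t0; first by rewrite subrr normr0 mulr0 expR0 mulr1.
(* The sign of [t - t0] is put into the exponent [a], so that the change of [q x * expR (- a * x)]
   from [t0] to [t] is nonpositive in both time directions. *)
have [a aE] : exists a, a * (t - t0) = B * `|t - t0|.
  by exists (B * Num.sg (t - t0)); rewrite -mulrA -normrEsg.
have dh x : is_derive x (1 : R) (fun x => q x * expR (- a * x))
    ((dq x - a * q x) * expR (- a * x)).
  have E := is_derive1_comp (is_derive_expR (- a * x))
    (is_deriveZ (- a) (is_derive_id x (1 : R))).
  apply: (is_derive_eq (is_deriveM (qdq x) E)).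
  by rewrite /= !scaler1 /GRing.scale/=; ring.
have [c _ E] := MVT_dist t0 t dh.
have : q t * expR (- a * t) <= q t0 * expR (- a * t0).
  rewrite -subr_le0 E mulrAC pmulr_lle0 ?expR_gt0// mulrBl mulrAC aE subr_le0.
  by rewrite (le_trans (ler_norm _))// normrM mulrAC ler_wpM2r.
rewrite -(ler_pM2r (expR_gt0 (a * t))) -!mulrA -!expRD !mulNr addNr expR0 mulr1.
by rewrite -aE mulrBr addrC.
Qed.

(** The derivative of [sqnorm (p t)] is a sum of [n + n] products, each at most [C * sqnorm (p t)]
    up to the factor 2; this gives the rate in the exponent. *)
Lemma gronwall_sqnorm (R : realType) n (p dp : R -> 'cV[R]_(n + n)) (C : R) :
  0 <= C ->
  (forall t, is_derive t (1 : R) p (dp t)) -> (forall t, `|dp t| <= C * `|p t|) ->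
  forall t0 t, sqnorm (p t) <=
    sqnorm (p t0) * expR (2 * (n + n)%:R * C * `|t - t0|).
Proof.
move=> C0 pdp dpC; apply: gronwall_growth (fun t => is_derive_sqnorm (pdp t)) _.
move=> t; rewrite normrM ger0_norm// -!mulrA ler_pM2l// (le_trans (ler_norm_sum _ _ _))//.
rewrite (le_trans (_ : _ <= \sum_(i < n + n) C * sqnorm (p t)))//; last first.
  by rewrite sumr_const card_ord -[leLHS]mulr_natl.
apply: ler_sum => i _; rewrite normrM.
apply: le_trans (ler_wpM2l C0 (norm_sqr_le_sqnorm (p t))).
rewrite expr2 mulrCA ler_pM// ?coord_le_norm//.
exact: le_trans (coord_le_norm _ _ _) (dpC t).
Qed.

Lemma gronwall_unique (R : realType) n (p dp : R -> 'cV[R]_(n + n)) (C t0 : R) :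
  0 <= C ->
  (forall t, is_derive t (1 : R) p (dp t)) -> (forall t, `|dp t| <= C * `|p t|) ->
  p t0 = 0 -> forall t, p t = 0.
Proof.
move=> C0 pdp dpC p0 t; apply: sqnorm_eq0.
rewrite (le_trans (gronwall_sqnorm C0 pdp dpC t0 t))// p0.
rewrite (_ : sqnorm _ = 0) ?mul0r// /sqnorm big1// => i _.
by rewrite mxE expr0n.
Qed.

Lemma periodic_le (R : realType) (q : R -> R) (tau c : R) :
  0 < tau -> (forall t, q (t + tau) = q t) ->
  (forall t, 0 <= t <= tau -> q t <= c) -> forall t, q t <= c.
Proof.
move=> tau0 qtau qc t.
have qn (k : nat) s : q (s + k%:R * tau) = q s.
  elim: k => [|k IH]; first by rewrite mul0r addr0.
  by rewrite -[k.+1]addn1 natrD mulrDl mul1r addrA qtau.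
have qz (j : int) s : q (s + j%:~R * tau) = q s.
  case: j => k; first exact: qn.
  by rewrite NegzE rmorphN/= mulNr -[LHS](qn k.+1) -pmulrn subrK.
(* Subtracting [Num.floor (t / tau)] periods brings [t] into [[0, tau]]. *)
rewrite -(qz (- Num.floor (t / tau))) qc// rmorphN/= mulNr subr_ge0 lerBlDr.
have /andP[h1 h2] := floor_itv (t / tau).
rewrite -ler_pdivlMr// h1/= -[tau in X in _ <= X + _]mul1r -mulrDl.
by rewrite -ler_pdivrMr// ltW// addrC -[1]/(1%:~R) -rmorphD.
Qed.

(** * The W^{1,2} norm controls the supremum norm *)

Lemma cvg_sum_real (R : realType) (I : finType) (T : Type) (F : set_system T)
    (FF : Filter F) (f : I -> T -> R) (l : I -> R) :
  (forall i, f i x @[x --> F] --> l i) ->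
  \sum_i f i x @[x --> F] --> \sum_i l i.
Proof. by move=> fl; apply: cvg_big => //; exact: add_continuous. Qed.

Lemma continuous_itv_integrable (R : realType) (f : R -> R) (a b : R) :
  continuous f ->
  (@lebesgue_measure R).-integrable `[a, b]%classic (EFin \o f).
Proof.
move=> cf; apply: continuous_compact_integrable; first exact: segment_compact.
exact: continuous_subspaceT.
Qed.

Lemma increment_le_integral (R : realType) (F dF phi : R -> R) (a b s t : R) :
  (forall x, is_derive x (1 : R) F (dF x)) -> continuous dF -> continuous phi ->
  (forall x, dF x <= phi x) -> (forall x, 0 <= phi x) ->
  a <= s -> s <= t -> t <= b ->
  ((F t - F s)%:E <= \int[@lebesgue_measure R]_(x in `[a, b]%classic) (phi x)%:E)%E.
Proof.
move=> FdF cdF cphi dFphi phi0 as_ st tb.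
move: st; rewrite le_eqVlt => /predU1P[->|st].
  by rewrite subrr integral_ge0// => x _; rewrite lee_fin.
rewrite EFinB -(@continuous_FTC2 _ dF F s t st); first last.
- by move=> x _; rewrite derive1E; have [] := FdF x.
- split=> [x _||]; first by have [] := FdF x.
  + exact/cvg_at_right_filter/(derivable_cont (FdF s)).
  + exact/cvg_at_left_filter/(derivable_cont (FdF t)).
- exact: continuous_subspaceT.
apply: (@le_trans _ _
    (\int[@lebesgue_measure R]_(x in `[s, t]%classic) (phi x)%:E)%E).
  apply: le_integral => //; first exact: continuous_itv_integrable.
    exact: continuous_itv_integrable.
  by move=> x _; rewrite lee_fin.
apply: ge0_subset_integral => //.
- by have /integrableP[] := continuous_itv_integrable a b cphi.
- by move=> x _; rewrite lee_fin.
- by apply: subset_itv; rewrite bnd_simp.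
Qed.

Lemma continuous_sqnorm (R : realType) n (g : R -> 'cV[R]_(n + n)) :
  (forall i, continuous (fun t => g t i 0)) -> continuous (fun t => sqnorm (g t)).
Proof.
move=> cg t; apply: cvg_sum_real => i.
by apply: (@cvg_comp _ _ _ _ (fun y : R => y ^+ 2) _ (nbhs (g t i 0))); [exact: cg|exact: exprn_continuous].
Qed.

(** The derivative of [sqnorm (g x)] is bounded by the integrand, so [sqnorm (g t)] exceeds
    [sqnorm (g s)] by at most the integral, for every [s]. Integrating this over [s] in [[0, tau]]
    gives the bound. *)
Lemma W12_norm_sup_bound (R : realType) n (g dg : R -> 'cV[R]_(n + n)) (tau t : R) :
  0 < tau -> (forall x, is_derive x (1 : R) g (dg x)) ->
  (forall i, continuous (fun x => dg x i 0)) -> 0 <= t <= tau ->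
  ((tau * sqnorm (g t))%:E <= (1 + tau)%:E *
    \int[@lebesgue_measure R]_(x in `[0%R, tau]%classic)
      (sqnorm (g x) + sqnorm (dg x))%:E)%E.
Proof.
move=> tau0 gdg cdg /andP[t0 ttau].
have cg i : continuous (fun x => g x i 0).
  by move=> x; exact: derivable_cont (is_derive_coord i 0 (gdg x)).
pose phi x := sqnorm (g x) + sqnorm (dg x).
have cphi : continuous phi.
  by move=> x; apply: cvgD; exact: continuous_sqnorm.
have phi0 x : 0 <= phi x by rewrite addr_ge0// sqnorm_ge0.
have iphi := @continuous_itv_integrable _ _ 0 tau cphi.
rewrite -/(phi _); under eq_integral do rewrite -/(phi _).
have : (\int[@lebesgue_measure R]_(x in `[0%R, tau]%classic) (phi x)%:E)%E \is a fin_num.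
  exact: integrable_fin_num iphi.
(* The integral is finite, so a real [r] can stand for it in the pointwise inequality below. *)
set I := (X in X \is a fin_num); move=> /fineK/esym; move: (fine I) => r IE.
pose dq x := 2 * \sum_i g x i 0 * dg x i 0.
have dqphi x : `|dq x| <= phi x.
  rewrite /dq normrM ger0_norm// (le_trans (ler_wpM2l _ (ler_norm_sum _ _ _)))//.
  rewrite mulr_sumr /phi /sqnorm -big_split/=; apply: ler_sum => i _.
  rewrite normrM -(real_normK (num_real (g x i 0))) -(real_normK (num_real (dg x i 0))).
  by rewrite -subr_ge0 (_ : _ - _ = (`|g x i 0| - `|dg x i 0|) ^+ 2) ?sqr_ge0//; ring.
have cdq : continuous dq.
  move=> x; apply: cvgMr; apply: cvg_sum_real => i.
  by apply: cvgM; [exact: cg | exact: cdg].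
have qs s : 0 <= s <= tau -> sqnorm (g t) - r <= phi s.
  move=> /andP[s0 stau]; rewrite (le_trans (_ : _ <= sqnorm (g s)))//; last first.
    by rewrite lerDl sqnorm_ge0.
  rewrite lerBlDl -lerBlDr -lee_fin -IE.
  have [st|/ltW ts] := leP s t.
    apply: (increment_le_integral (fun x => is_derive_sqnorm (gdg x)) cdq cphi _ phi0 s0 st ttau).
    by move=> x; rewrite (le_trans (ler_norm _))//; exact: dqphi.
  (* For [t] before [s] the same estimate is applied to the negated function. *)
  have := increment_le_integral (fun x => is_deriveN (is_derive_sqnorm (gdg x))) _ cphi _ phi0 t0 ts stau.
  rewrite !opprfctE opprK addrC; apply.
    by move=> x; apply: cvgN; exact: cdq.
  by move=> x; rewrite (le_trans (ler_norm _))// normrN; exact: dqphi.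
have : (\int[@lebesgue_measure R]_(x in `[0%R, tau]%classic)
    (sqnorm (g t) - r)%:E <= I)%E.
  apply: le_integral => //.
    exact: (@continuous_itv_integrable _ (cst (sqnorm (g t) - r)) 0 tau
      (fun x => cvg_cst _)).
  by move=> x; rewrite inE/= in_itv/= lee_fin; exact: qs.
rewrite integral_cst//= lebesgue_measure_itv/= lte_fin tau0 IE -EFinB subr0.
rewrite -[X in (_ <= _ * X)%E]/I IE -!EFinM !lee_fin.
by rewrite mulrBl mulrDl mul1r lerBlDr mulrC (mulrC r).
Qed.

(** * Compactness *)

Lemma norm_trmx (R : realType) p q (x : 'M[R]_(p, q)) : `|x^T| = `|x|.
Proof.
apply/eqP; rewrite eq_le; apply/andP; split; apply: mx_norm_le => // i j.
  by rewrite mxE coord_le_norm.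
by have := coord_le_norm x^T j i; rewrite mxE.
Qed.

Lemma compact_rV_ball (R : realType) m (r : R) :
  compact [set x : 'rV[R]_m | `|x| <= r].
Proof.
apply: bounded_closed_compact.
  by exists r; split; [exact: num_real|move=> s rs x /= /le_trans; apply; exact: ltW].
apply: (@preimage_closed _ _ _ [set s : R | s <= r] _ (@closed_le R r)).
by move=> x _; exact: norm_continuous.
Qed.

(* The library proves compactness of bounded closed sets for row vectors only,
   hence the transpositions in this lemma and the next one. *)
Lemma continuous_cV_bounded (R : realType) m (g : 'cV[R]_m -> R) (r : R) :
  continuous g -> exists C, 0 <= C /\ forall x, `|x| <= r -> `|g x| <= C.
Proof.
move=> cg; have [r0|r0] := ltP r 0.
  by exists 0; split=> // x /le_lt_trans/(_ r0); rewrite ltNge normr_ge0.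
have cgT : continuous (fun x : 'rV[R]_m => `|g x^T|).
  move=> x.
  have cT : {for x, continuous (fun y : 'rV[R]_m => y^T)}.
    apply/(@cvgrPdist_lt _ _ _ (nbhs x) (nbhs_filter x)) => e e0.
    have := nbhsx_ballx x e e0; rewrite -ball_normE.
    by apply: filterS => y /=; rewrite -linearB/= norm_trmx.
  exact: (@cvg_norm _ _ _ (nbhs x) _ _ _ (continuous_comp cT (cg x^T))).
have [||c _ gc] := EVT_max_rV (f := fun x : 'rV[R]_m => `|g x^T|) _ (@compact_rV_ball R m r).
- by exists 0; rewrite /= normr0.
- exact: continuous_subspaceT.
exists `|g c^T|; split=> // x xr.
by rewrite -[x]trmxK gc// inE/= norm_trmx.
Qed.

Lemma uniform_near_ball (R : realType) m (Lambda : set R) (mu r : R)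
    (G : R * 'cV[R]_m -> R) :
  open Lambda -> Lambda mu -> {within Lambda `*` setT, continuous G} ->
  forall e, 0 < e -> \forall d \near 0^'+, forall l x z,
    `|l - mu| < d -> `|x| <= r -> `|z - x| < d -> `|G (l, z) - G (mu, x)| <= e.
Proof.
move=> oL Lmu cG e e0.
have GP (x : 'cV[R]_m) : exists2 d, 0 < d & forall l z, `|l - mu| < d ->
    `|z - x| < d -> `|G (mu, x) - G (l, z)| <= e / 2.
  have : {for (mu, x), continuous G}.
    have oLT : open (Lambda `*` [set: 'cV[R]_m]).
      rewrite (_ : _ `*` _ = fst @^-1` Lambda); last first.
        by apply/seteqP; split => [x'/= []|x' /=].
      by apply: open_comp => // x' _; exact: cvg_fst.
    by move: cG; rewrite continuous_open_subspace//; apply; rewrite inE.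
  move=> /cvgrPdist_le/(_ _ (divr_gt0 e0 (ltr0n _ 2)))/nbhs_ballP[d /= d0 dG].
  exists d => // l z lmu zx; apply: (dG (l, z)); split => /=.
    by rewrite /ball/= distrC.
  by rewrite -ball_normE/= distrC.
(* Compactness as a covering property: what holds for [x'] near each point of the ball and [i] near
   [(mu, 0)] holds on the whole ball at once for [i] near [(mu, 0)]. The second component of [i] is
   the displacement [z - x]. *)
have /compact_near_coveringP/(_ _ (nbhs ((mu, 0) : R * 'cV[R]_m))
  (fun i x => `|G (i.1, x^T + i.2) - G (mu, x^T)| <= e) _) :=
  @compact_rV_ball R m r.
have H (x : 'rV[R]_m) : `|x| <= r ->
    \forall x' \near x & i \near nbhs ((mu, 0) : R * 'cV[R]_m),
      `|G (i.1, x'^T + i.2) - G (mu, x'^T)| <= e.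
  move=> _; have [d d0 dG] := GP x^T.
  (* With radius [d / 2], both [x'] and the displaced [x' + h] stay within [d] of [x], so both
     values of [G] can be compared with the one at [x]. *)
  exists (ball x (d / 2), ball (mu, 0) (d / 2)) => /=.
    by split; apply: nbhsx_ballx; rewrite divr_gt0.
  move=> [x' [l h]] [/=]; rewrite -ball_normE/= => xx' [/=].
  rewrite -ball_normE/= => lmu; rewrite -ball_normE/= sub0r normrN => hd.
  have lmu' : `|l - mu| < d by rewrite distrC (lt_trans lmu)// ltr_pdivrMr// ltr_pMr// ltr1n.
  have xx'd : `|x'^T - x^T| < d / 2 by rewrite -linearB/= norm_trmx distrC.
  have -> : G (l, x'^T + h) - G (mu, x'^T) =
      (G (mu, x^T) - G (mu, x'^T)) - (G (mu, x^T) - G (l, x'^T + h)) by ring.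
  rewrite (splitr e) (le_trans (ler_normB _ _))// lerD//; apply: dG => //.
  - by rewrite subrr normr0.
  - by rewrite (lt_trans xx'd)// ltr_pdivrMr// ltr_pMr// ltr1n.
  - by rewrite addrAC (le_lt_trans (ler_normD _ _))// (splitr d) ltrD.
move=> /(_ H)/nbhs_ballP[d /= d0 dG].
near=> d' => l x z lmu xr zx.
have d'd : d' < d by near: d'; exact: nbhs_right_lt.
have := dG (l, z - x) _ x^T; rewrite /= trmxK subrKC; apply; last by rewrite norm_trmx.
split; first by rewrite /= -ball_normE/= distrC (lt_trans lmu).
by rewrite /= -ball_normE/= sub0r normrN (lt_trans zx).
Unshelve. all: by end_near. Qed.

(** A single ultrafilter makes all bounded sequences converge at once, for every [t]; this replaces
    the extraction of a subsequence. *)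
Lemma ultra_pointwise_limit (R : realType) m (U : set_system nat)
    (d : nat -> R -> 'cV[R]_m) :
  UltraFilter U ->
  (forall t, exists r, \forall k \near U, `|d k t| <= r) ->
  exists w : R -> 'cV[R]_m, forall t, d k t @[k --> U] --> w t.
Proof.
move=> UU dr.
suff dl : forall t, exists l : 'cV[R]_m, d k t @[k --> U] --> l.
  by have [w dw] := choice dl; exists w.
move=> t; have [r dkr] := dr t.
have dtl : forall i, exists l : R, d k t i 0 @[k --> U] --> l.
  move=> i; have UK : U ((fun k => d k t i 0) @^-1` `[- r, r]%classic).
    apply: filterS dkr => k dkr /=; rewrite in_itv/= -ler_norml.
    exact: le_trans (coord_le_norm _ _ _) dkr.
  (* Compactness gives a cluster point, and a cluster point of an ultrafilter is its limit:
     otherwise the complement of some neighbourhood would belong to it. *)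
  have [l [_ cl]] := @segment_compact R (- r) r (d k t i 0 @[k --> U]) _ UK.
  exists l => B lB.
  have [//|nB] := in_ultra_setVsetC ((fun k => d k t i 0) @^-1` B) UU.
  by have [y []] := cl (~` B) B nB lB.
have [l dl] := choice dtl.
exists (\col_i l i); apply/cvgrPdist_le => e e0.
have : \forall k \near U, forall i, `|l i - d k t i 0| <= e.
  by apply: filter_forall => i; move/cvgrPdist_le : (dl i); exact.
apply: filterS => k H; apply: mx_norm_le => [|i j]; first exact: ltW.
by rewrite ord1 !mxE.
Qed.

(** * Linearization along v0 *)

(** Differentiability without quotients and with a weak inequality, a form that survives pointwise
    limits. *)
Lemma is_derive_of_estimate (R : realType) (V : normedModType R) (w : R -> V)
    (s : R) (l : V) :
  (forall e, 0 < e -> \forall t \near s,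
     `|w t - w s - (t - s) *: l| <= e * `|t - s|) ->
  is_derive s (1 : R) w l.
Proof.
move=> H.
suff cl : h^-1 *: ((w \o shift s) (h *: (1 : R)) - w s) @[h --> 0^'] --> l.
  by apply: DeriveDef; [apply/cvg_ex; exists l | exact/cvg_lim].
apply/cvgrPdist_le => e e0; have /nbhs_ballP[d /= d0 dH] := H _ e0.
near=> h.
have h0 : h != 0 by near: h; exact: nbhs_dnbhs_neq.
have hd : ball s d (h + s).
  by rewrite -ball_normE/= opprD addrCA subrr addr0 normrN; near: h; exact: dnbhs0_lt.
have := dH _ hd; rewrite /= addrK => wh.
rewrite -(ler_pM2l (_ : 0 < `|h|)) ?normr_gt0// -normrZ scalerBr scalerA.
by rewrite divff// scale1r [h%:A]mulr1 -normrN opprB (mulrC _ e).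
Unshelve. all: by end_near. Qed.

Lemma is_derive_scalel (R : realType) (V : normedModType R) (v : V) (s : R) :
  is_derive s (1 : R) (fun t : R => t *: v) v.
Proof.
apply: is_derive_of_estimate => e e0; near=> t.
by rewrite scalerBl subrr normr0 mulr_ge0// ltW.
Unshelve. all: by end_near. Qed.

(** Continuity of second partials controls Hessians entry by entry; this turns such control into a
    bound on vectors. *)
Lemma Jmat_mul_small (R : realType) n (e : R) : 0 < e ->
  exists2 e', 0 < e' & forall D : 'M[R]_(n + n), (forall i j, `|D i j| <= e') ->
    forall x : 'cV[R]_(n + n), `|Jmat *m (D *m x)| <= e * `|x|.
Proof.
move=> e0; pose K : R := (n + n)%:R * `|@Jmat R n| * (n + n)%:R.
have K0 : 0 <= K by rewrite !mulr_ge0.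
have K1 : 0 < K + 1 by rewrite ltr_wpDl.
exists (e / (K + 1)) => [|D De x]; first by rewrite divr_gt0.
have Dn : `|D| <= e / (K + 1) by apply: mx_norm_le => //; rewrite ltW// divr_gt0.
rewrite (le_trans (mulmx_norm_le _ _))//.
rewrite (le_trans (ler_wpM2l _ (mulmx_norm_le _ _)))// ?mulr_ge0// !mulrA -/K.
rewrite ler_wpM2r// (le_trans (ler_wpM2l K0 Dn))// mulrCA ger_pMr//.
by rewrite ler_pdivrMr// mul1r lerDl.
Qed.

(** For dividing an error budget by a bound [b] that may vanish: the [+ 1] keeps the denominator
    positive. *)
Lemma div_succ_mul_le (R : realType) (e a b : R) :
  0 <= e -> 0 < a -> 0 <= b -> e / (a * (b + 1)) * b <= e / a.
Proof.
move=> e0 a0 b0; rewrite invfM mulrA -mulrA -[leRHS]mulr1.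
apply: ler_wpM2l; first by rewrite divr_ge0// ltW.
by rewrite mulrC ler_pdivrMr ?mul1r ?lerDl// ltr_wpDl.
Qed.

Lemma mulmx_distrB (R : realType) n p (J P Q : 'M[R]_n) (x : 'M[R]_(n, p)) :
  J *m P *m x - J *m Q *m x = J *m ((P - Q) *m x).
Proof. by rewrite mulmxBl mulmxBr !mulmxA. Qed.

Section Linearization.
Context (R : realType) (n : nat) (tau : R) (M : 'M[R]_(n + n)).
Context (Lambda : set R) (H : R -> 'cV[R]_(n + n) -> R).
Context (v0 : R -> 'cV[R]_(n + n)) (mu : R).
Hypothesis tau_gt0 : 0 < tau.
Hypothesis orthM : orth_mx M.
Hypothesis open_Lambda : open Lambda.
Hypothesis Lambda_mu : Lambda mu.
Hypothesis C2_H : forall l, Lambda l -> C2 (H l).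
Hypothesis cont_hess : forall i j : 'I_(n + n),
  {within Lambda `*` setT,
    continuous (fun p : R * 'cV[R]_(n + n) => partial j (partial i (H p.1)) p.2)}.
Hypothesis sol_v0 : forall l, Lambda l -> is_sol H l tau M v0.

(** The Hamiltonian vector field, and below it the coefficient matrix of the linearized equation. *)
Let F l z := Jmat *m grad (H l) z.
Let A t := Jmat *m hess (H mu) (v0 t).

Lemma is_sol_derive l u : is_sol H l tau M u ->
  forall t, is_derive t (1 : R) u (F l (u t)).
Proof. by move=> [du _] t; have [? ?] := du t; apply: DeriveDef. Qed.

(** Orthogonality of [M] makes [sqnorm (v0 t)] periodic, so its maximum over one period bounds it
    everywhere. *)
Lemma sol_bounded : exists r, forall t, `|v0 t| <= r.
Proof.
have dq t := is_derive_sqnorm (is_sol_derive (sol_v0 Lambda_mu) t).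
have cq : {within `[0, tau], continuous (fun t => sqnorm (v0 t))}.
  by apply: continuous_subspaceT => t; exact: derivable_cont (dq t).
have [c _ qc] := EVT_max (ltW tau_gt0) cq.
have q0 := sqnorm_ge0 (v0 c).
have qle : forall t, sqnorm (v0 t) <= sqnorm (v0 c).
  apply: (periodic_le tau_gt0) => [t|t t0tau]; last by apply: qc; rewrite in_itv.
  by rewrite (sol_v0 Lambda_mu).2 orth_sqnorm.
exists (1 + sqnorm (v0 c)) => t.
rewrite -(@ler_pXn2r _ 2)// ?nnegrE ?addr_ge0//.
rewrite (le_trans (norm_sqr_le_sqnorm _))// (le_trans (qle t))//.
by rewrite sqrrD expr1n mul1r; have := sqr_ge0 (sqnorm (v0 c)); lra.
Qed.

(** The orbit of [v0] lies in a ball, where compactness makes the continuity of the second partials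
    uniform; hence [d] does not depend on [t]. *)
Lemma hess_near e : 0 < e -> \forall d \near 0^'+, forall l t z,
  `|l - mu| < d -> `|z - v0 t| < d ->
  forall i j, `|partial j (partial i (H l)) z -
    partial j (partial i (H mu)) (v0 t)| <= e.
Proof.
move=> e0; have [r v0r] := sol_bounded.
have : \forall d \near 0^'+, forall i j l x z,
    `|l - mu| < d -> `|x| <= r -> `|z - x| < d ->
    `|partial j (partial i (H l)) z - partial j (partial i (H mu)) x| <= e.
  apply: filter_forall => i; apply: filter_forall => j.
  exact: (@uniform_near_ball _ _ _ _ r _ open_Lambda Lambda_mu (@cont_hess i j) _ e0).
by apply: filterS => d Hd l t z lmu zv i j; exact: Hd.
Qed.

(** Both field values are taken at the same [l], so the mean value theorem writes their difference
    with second partials of [H l] near the orbit, and these are close to those of [H mu] on it. *)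
Lemma linearization_error e : 0 < e -> \forall d \near 0^'+, forall l t z,
  Lambda l -> `|l - mu| < d -> `|z - v0 t| < d ->
  `|F l z - F l (v0 t) - A t *m (z - v0 t)| <= e * `|z - v0 t|.
Proof.
move=> /(@Jmat_mul_small _ n)[e' e'0 He'].
have := hess_near e'0; apply: filterS => d Hd l t z Ll lmu zv.
have mvt i := multivariate_mean_value (v0 t) z (fun j => (C2_H Ll i j).2.1).
have [xi xiP] := choice mvt.
(* The evaluation point varies with the row and the column, so [D] is not a difference of two
   Hessians; its entries are small all the same. *)
pose D := \matrix_(i, j) (partial j (partial i (H l)) (xi i j) -
  partial j (partial i (H mu)) (v0 t)) : 'M[R]_(n + n).
have -> : F l z - F l (v0 t) - A t *m (z - v0 t) = Jmat *m (D *m (z - v0 t)).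
  rewrite /F /A -mulmxBr -mulmxA -mulmxBr; congr (_ *m _).
  apply/matrixP => i j; rewrite ord1 !mxE (xiP i).2 -sumrB.
  by apply: eq_bigr => k _; rewrite !mxE mulrBl.
apply: He' => i j; rewrite mxE.
exact: Hd l t (xi i j) lmu (le_lt_trans ((xiP i).1 j) zv) i j.
Qed.

Lemma A_bounded : exists2 a, 0 <= a & forall t (x : 'cV[R]_(n + n)), `|A t *m x| <= a * `|x|.
Proof.
have [r v0r] := sol_bounded.
have Cij (ij : 'I_(n + n) * 'I_(n + n)) : exists C, 0 <= C /\ forall x,
    `|x| <= r -> `|partial ij.2 (partial ij.1 (H mu)) x| <= C.
  by apply: continuous_cV_bounded; exact: (C2_H Lambda_mu ij.1 ij.2).2.2.2.
have [C CP] := choice Cij.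
have S0 : 0 <= \sum_ij C ij by apply: sumr_ge0 => ij _; case: (CP ij).
exists ((n + n)%:R * ((n + n)%:R * `|@Jmat R n| * \sum_ij C ij)).
  by rewrite !mulr_ge0.
move=> t x; rewrite /A -mulmxA (le_trans (mulmx_norm_le _ _))//.
rewrite (le_trans (ler_wpM2l _ (mulmx_norm_le _ _)))// ?mulr_ge0// -!mulrA.
rewrite ler_wpM2l// mulrCA ler_wpM2l// ler_wpM2l// ler_wpM2r//.
apply: mx_norm_le => // i j; rewrite mxE.
rewrite (le_trans ((CP (i, j)).2 _ (v0r t)))// (bigD1 (i, j))//= lerDl.
by apply: sumr_ge0 => ij _; case: (CP ij).
Qed.

Lemma A_continuous s e : 0 < e ->
  \forall t \near s, forall x : 'cV[R]_(n + n), `|A t *m x - A s *m x| <= e * `|x|.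
Proof.
move=> /(@Jmat_mul_small _ n)[e' e'0 He'].
near (0:R)^'+ => d.
have d0 : 0 < d by [].
have Hd : forall l t z, `|l - mu| < d -> `|z - v0 t| < d ->
    forall i j, `|partial j (partial i (H l)) z -
      partial j (partial i (H mu)) (v0 t)| <= e'.
  by near: d; exact: hess_near.
have : {for s, continuous v0} by exact: derivable_cont (is_sol_derive (sol_v0 Lambda_mu) s).
move=> /cvgr_distC_lt/(_ _ d0); apply: filterS => t td x.
rewrite mulmx_distrB.
apply: He' => i j; rewrite mxE [X in X + _]mxE [X in _ + X]mxE [X in _ - X]mxE.
by apply: (Hd mu s (v0 t)) => //; rewrite subrr normr0.
Unshelve. all: by end_near. Qed.

Lemma sol_lipschitz : exists2 L, 0 <= L & forall s t, `|v0 t - v0 s| <= L * `|t - s|.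
Proof.
have [r v0r] := sol_bounded.
have Ci i : exists C, 0 <= C /\ forall x, `|x| <= r -> `|partial i (H mu) x| <= C.
  by apply: continuous_cV_bounded; exact: (C2_H Lambda_mu i i).2.2.1.
have [C CP] := choice Ci.
have S0 : 0 <= \sum_i C i by apply: sumr_ge0 => i _; case: (CP i).
exists ((n + n)%:R * `|@Jmat R n| * \sum_i C i); first by rewrite !mulr_ge0.
move=> s t; apply: mean_value_inequality => [||x _]; first by rewrite !mulr_ge0.
  exact: is_sol_derive (sol_v0 Lambda_mu).
rewrite (le_trans (mulmx_norm_le _ _))// ler_wpM2l ?mulr_ge0//.
apply: mx_norm_le => // i j; rewrite mxE.
rewrite (le_trans ((CP i).2 _ (v0r x)))// (bigD1 i)//= lerDl.
by apply: sumr_ge0 => k _; case: (CP k).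
Qed.

(** The linearization error with tolerance 1, added to the bound on [A]. The constant is uniform in
    [l], as Gronwall's inequality along a sequence requires. *)
Lemma difference_growth : exists2 C, 0 <= C & \forall d \near 0^'+,
  forall l u, Lambda l -> `|l - mu| < d -> (forall t, `|u t - v0 t| < d) ->
  forall t, `|F l (u t) - F l (v0 t)| <= C * `|u t - v0 t|.
Proof.
have [a a0 Aa] := A_bounded; exists (1 + a); first by rewrite addr_ge0.
have := linearization_error ltr01; apply: filterS => d Hd l u Ll lmu uv t.
rewrite -(subrK (A t *m (u t - v0 t)) (_ - _)) (le_trans (ler_normD _ _))//.
by rewrite mulrDl lerD// Hd.
Qed.

(** * Limits of rescaled differences of solutions *)

Section Limit.
Context (lam : nat -> R) (u : nat -> R -> 'cV[R]_(n + n)) (c : nat -> R).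
Context (t0 B : R) (U : set_system nat).
Hypothesis Lambda_lam : forall k, Lambda (lam k).
Hypothesis cvg_lam : lam @ \oo --> mu.
Hypothesis sol_u : forall k, is_sol H (lam k) tau M (u k).
Hypothesis cvg_u :
  forall e, 0 < e -> \forall k \near \oo, forall t, `|u k t - v0 t| < e.
Hypothesis normalized_u : forall k, `|c k *: (u k t0 - v0 t0)| <= B.
Hypothesis ultraU : UltraFilter U.
Hypothesis finerU : \oo `<=` U.

(** The factors [c k] are left free for two uses: reciprocal time steps, giving difference quotients
    of [v0], and reciprocal norms of differences at one time. Since [v0] also solves the equation
    for [lam k], the derivative of [d k] is [dd k]. *)
Let d k t := c k *: (u k t - v0 t).
Let dd k t := c k *: (F (lam k) (u k t) - F (lam k) (v0 t)).

Let dP k t : is_derive t (1 : R) (d k) (dd k t).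
Proof.
apply: is_deriveZ; apply: is_deriveB; first exact: is_sol_derive (sol_u k) t.
exact: is_sol_derive (sol_v0 (Lambda_lam k)) t.
Qed.

Let near_d (P : nat -> R -> Prop) (r : R) : 0 < r ->
  (forall k, `|lam k - mu| < r -> (forall t, `|u k t - v0 t| < r) ->
    forall t, P k t) -> \forall k \near \oo, forall t, P k t.
Proof.
move=> r0 HP; have := cvg_u r0; move/cvgr_distC_lt : cvg_lam => /(_ _ r0).
by apply: filterS2 => k lamk uk t; exact: HP.
Qed.

Let scaled_error e : 0 < e ->
  \forall k \near \oo, forall t, `|dd k t - A t *m d k t| <= e * `|d k t|.
Proof.
move=> e0; near (0 : R)^'+ => r; have r0 : 0 < r by [].
apply: (near_d r0) => k lamk uk t.
rewrite /dd /d -scalemxAr -scalerBr !normrZ mulrCA ler_wpM2l//.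
move: k lamk uk t; near: r.
have := linearization_error e0; apply: filterS => r Hr k lamk uk t.
exact: Hr.
Unshelve. all: by end_near. Qed.

Let scaled_growth : exists2 C, 0 <= C &
  \forall k \near \oo, forall t, `|dd k t| <= C * `|d k t|.
Proof.
have [C C0 HC] := difference_growth; exists C => //.
near (0 : R)^'+ => r; have r0 : 0 < r by [].
apply: (near_d r0) => k lamk uk t.
rewrite /dd /d !normrZ mulrCA ler_wpM2l//.
move: k lamk uk t; near: r; move: HC; apply: filterS => r Hr k lamk uk t.
exact: Hr.
Unshelve. all: by end_near. Qed.

(** Gronwall's inequality spreads the bound [B] at [t0] to bounded time intervals, uniformly in
    [k]. *)
Let scaled_bounded x : exists2 r, 0 <= r &
  \forall k \near \oo, forall t, `|t - t0| <= x -> `|d k t| <= r.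
Proof.
have [C C0 dC] := scaled_growth.
pose K := (n + n)%:R * B ^+ 2 * expR (2 * (n + n)%:R * C * x).
have B0 : 0 <= B := le_trans (normr_ge0 _) (normalized_u 0).
have K0 : 0 <= K by rewrite !mulr_ge0.
exists (1 + K); first by rewrite addr_ge0.
move: dC; apply: filterS => k dC t tx.
rewrite -(@ler_pXn2r _ 2)// ?nnegrE ?addr_ge0//.
rewrite (le_trans (norm_sqr_le_sqnorm _))//.
rewrite (le_trans (gronwall_sqnorm C0 (dP k) dC t0 t))//.
rewrite (@le_trans _ _ K)//; last by rewrite sqrrD expr1n mul1r; have := sqr_ge0 K; lra.
rewrite ler_pM// ?sqnorm_ge0// ?expR_ge0//.
  rewrite (le_trans (sqnorm_le_norm _))// ler_wpM2l// lerXn2r// ?nnegrE//.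
  exact: normalized_u.
by rewrite ler_expR ler_wpM2l// !mulr_ge0.
Qed.

(** The neighbourhood of [s] is chosen before [k]: this uniform differentiability is what lets the
    equation pass to the limit. *)
Let increment_estimate s e : 0 < e -> \forall t \near s, \forall k \near \oo,
  `|d k t - d k s - (t - s) *: (A s *m d k s)| <= e * `|t - s|.
Proof.
have e_split : e = e / 4 + e / 4 + e / 2 by field.
move=> e0; have [C C0 dC] := scaled_growth; have [a a0 Aa] := A_bounded.
(* The extra 1 covers every time within distance 1 of [s]. *)
have [r r0 dr] := scaled_bounded (`|s - t0| + 1).
(* [e1] is the tolerance for the linearization error and for the variation of [A], each multiplied
   by at most [r]. [e2] limits [t - s], so that the variation of [d k], at most [C * r * |t - s|],
   contributes at most [e / 2] after applying [A s]. *)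
have e1 : 0 < e / (4 * (r + 1)) by rewrite divr_gt0// mulr_gt0// ltr_wpDl.
have e2 : 0 < e / (2 * (a * (C * r) + 1)).
  by rewrite divr_gt0// mulr_gt0// ltr_wpDl// !mulr_ge0.
have /nbhs_ballP[h /= h0 Ah] := A_continuous s e1.
near=> t.
have ts1 : `|t - s| <= 1.
  by rewrite distrC; near: t; exact: cvgr_dist_le.
have tse : `|t - s| <= e / (2 * (a * (C * r) + 1)).
  by rewrite distrC; near: t; exact: cvgr_dist_le.
have tsh : `|t - s| < h.
  by rewrite distrC; near: t; exact: cvgr_dist_lt.
have := scaled_error e1; move: dr dC.
apply: filterS3 => k dr dC de.
have dfE x : is_derive x (1 : R) (fun x => d k x - x *: (A s *m d k s))
    (dd k x - A s *m d k s).
  exact: is_deriveB (dP k x) (is_derive_scalel _ x).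
have -> : d k t - d k s - (t - s) *: (A s *m d k s) =
    (d k t - t *: (A s *m d k s)) - (d k s - s *: (A s *m d k s)).
  rewrite scalerBl !opprB [LHS]addrACA [RHS]addrACA; congr (_ + _).
  exact: addrC.
apply: (mean_value_inequality (ltW e0) dfE) => x xs.
have near_t0 y : `|y - s| <= 1 -> `|d k y| <= r.
  move=> ys; apply: dr.
  have -> : y - t0 = (s - t0) + (y - s) by ring.
  by rewrite (le_trans (ler_normD _ _))// lerD2l.
have dx : `|d k x| <= r by apply: near_t0; exact: le_trans xs ts1.
have dxs : `|d k x - d k s| <= C * r * `|x - s|.
  apply: mean_value_inequality (dP k) _ => [|y yx]; first by rewrite mulr_ge0.
  rewrite (le_trans (dC y))// ler_wpM2l//; apply: near_t0.
  exact: le_trans yx (le_trans xs ts1).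
have split3 (X Y Z W : 'cV[R]_(n + n)) : X - W = (X - Y) + (Y - Z) + (Z - W).
  by rewrite !subrKA.
(* Linearization error, variation of [A], and variation of [d k], in this order. *)
rewrite (split3 _ (A x *m d k x) (A s *m d k x)).
have x1 : `|dd k x - A x *m d k x| <= e / 4.
  rewrite (le_trans (de x))// (le_trans (ler_wpM2l (ltW e1) dx))//.
  by rewrite div_succ_mul_le// ltW.
have x2 : `|A x *m d k x - A s *m d k x| <= e / 4.
  have bx : ball s h x by rewrite -ball_normE/= distrC (le_lt_trans xs).
  rewrite (le_trans (Ah x bx _))// (le_trans (ler_wpM2l (ltW e1) dx))//.
  by rewrite div_succ_mul_le// ltW.
have x3 : `|A s *m d k x - A s *m d k s| <= e / 2.
  rewrite -mulmxBr (le_trans (Aa s _))// (le_trans (ler_wpM2l a0 dxs))//.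
  have K0 : 0 <= a * (C * r) by rewrite !mulr_ge0.
  rewrite mulrA (le_trans (ler_wpM2l K0 (le_trans xs tse)))//.
  by rewrite mulrC div_succ_mul_le// ltW.
rewrite (le_trans (ler_normD _ _))// (le_trans (lerD (ler_normD _ _) (lexx _)))//.
rewrite e_split; exact: lerD (lerD x1 x2) x3.
Unshelve. all: by end_near. Qed.

(** The increment estimates and the relation with [M] hold for the rescaled differences, and both
    are preserved by limits along [U]. *)
Lemma linearized_limit : exists w : R -> 'cV[R]_(n + n),
  [/\ forall t, c k *: (u k t - v0 t) @[k --> U] --> w t,
      forall t, is_derive t (1 : R) w (A t *m w t) &
      forall t, w (t + tau) = M *m w t].
Proof.
have [w dw] : exists w : R -> 'cV[R]_(n + n), forall t, d k t @[k --> U] --> w t.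
  apply: ultra_pointwise_limit => t; have [r _ dr] := scaled_bounded `|t - t0|.
  by exists r; apply: finerU; move: dr; apply: filterS => k; exact.
have cmul (N : 'M[R]_(n + n)) t : N *m d k t @[k --> U] --> N *m w t.
  have K0 : 0 < (n + n)%:R * `|N| + 1 by rewrite ltr_wpDl// mulr_ge0.
  apply/cvgrPdist_le => e e0.
  move/cvgrPdist_le : (dw t) => /(_ _ (divr_gt0 e0 K0)); apply: filterS => k dk.
  rewrite -mulmxBr (le_trans (mulmx_norm_le _ _))//.
  rewrite (le_trans (ler_wpM2l _ dk))// ?mulr_ge0// mulrCA ger_pMr//.
  by rewrite ler_pdivrMr// mul1r lerDl.
exists w; split=> // s.
  apply: is_derive_of_estimate => e e0.
  have := increment_estimate s e0; apply: filterS => t /finerU dt.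
  have cv : d k t - d k s - (t - s) *: (A s *m d k s) @[k --> U] -->
      w t - w s - (t - s) *: (A s *m w s).
    exact: cvgB (cvgB (dw t) (dw s)) (cvgZ (cvg_cst _) (cmul _ s)).
  exact: (cvgr_to_le (cvg_norm cv) dt).
apply: (@cvg_unique _ (@norm_hausdorff _ _) (d k (s + tau) @[k --> U])); first exact: dw.
rewrite (_ : (fun k => d k (s + tau)) = (fun k => M *m d k s)); first exact: cmul.
by apply/funext => k; rewrite /d (sol_u k).2 (sol_v0 Lambda_mu).2 -mulmxBr scalemxAr.
Qed.

End Limit.

(** * Uniqueness, time shifts and uniform convergence *)

Lemma linear_unique (w : R -> 'cV[R]_(n + n)) (t0 : R) :
  (forall t, is_derive t (1 : R) w (A t *m w t)) -> w t0 = 0 ->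
  forall t, w t = 0.
Proof.
move=> dw w0; have [a a0 Aa] := A_bounded.
exact: gronwall_unique a0 dw (fun t => Aa t (w t)) w0.
Qed.

Lemma is_sol_shift l (u : R -> 'cV[R]_(n + n)) (theta : R) :
  is_sol H l tau M u -> is_sol H l tau M (fun t => u (t + theta)).
Proof.
move=> [du uM]; split=> t; last by rewrite addrAC uM.
have E : (fun h : R => h^-1 *: (((fun t => u (t + theta)) \o shift t) (h *: 1) - u (t + theta)))
  = (fun h : R => h^-1 *: ((u \o shift (t + theta)) (h *: 1) - u (t + theta))).
  by apply/funext => h /=; rewrite addrA.
by rewrite /derivable /derive E; exact: du.
Qed.

(** By [difference_growth] the distance to [v0] satisfies a Gronwall bound, so a nearby solution
    that meets [v0] at equal times coincides with it. *)
Lemma sol_unique_near : \forall r \near 0^'+, forall l u t0, Lambda l ->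
  `|l - mu| < r -> is_sol H l tau M u -> (forall t, `|u t - v0 t| < r) ->
  u t0 = v0 t0 -> forall t, u t = v0 t.
Proof.
have [C C0 HC] := difference_growth; move: HC.
apply: filterS => r Hr l u t0 Ll lmu solu ur ut0 t.
have dp s : is_derive s (1 : R) (u - v0) (F l (u s) - F l (v0 s)).
  exact: is_deriveB (is_sol_derive solu s) (is_sol_derive (sol_v0 Ll) s).
apply/eqP; rewrite -subr_eq0; apply/eqP.
apply: (gronwall_unique C0 dp (Hr l u Ll lmu ur) (t0 := t0)).
by rewrite -[LHS]/(u t0 - v0 t0) ut0 subrr.
Qed.

Lemma continuous_field l u i : Lambda l -> is_sol H l tau M u ->
  continuous (fun t => F l (u t) i 0).
Proof.
move=> Ll solu.
have -> : (fun t => F l (u t) i 0) =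
    (fun t => \sum_k Jmat i k * partial k (H l) (u t)).
  apply/funext => t; rewrite mxE; apply: eq_bigr => k _.
  by rewrite [X in _ * X]mxE.
move=> t; apply: cvg_sum_real => k; apply: cvgM; first exact: cvg_cst.
have cu : {for t, continuous u} := derivable_cont (is_sol_derive solu t).
exact: (continuous_comp cu ((C2_H Ll k k).2.2.1 (u t))).
Qed.

(** The difference of two solutions is again multiplied by [M] over one period, so its Euclidean
    norm is periodic and the supremum bound on [[0, tau]] holds on the whole line. *)
Lemma W12_cvg_uniform (lam : nat -> R) (v : nat -> R -> 'cV[R]_(n + n)) :
  (forall k, Lambda (lam k)) -> (forall k, is_sol H (lam k) tau M (v k)) ->
  (fun k => W12_dist2 tau (v k) v0) @ \oo --> 0%E ->
  forall e, 0 < e -> \forall k \near \oo, forall t, `|v k t - v0 t| < e.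
Proof.
move=> Llam solv cv e e0.
(* Chosen so that [(1 + tau) * e' = tau * (e ^+ 2 / 2)]; the half leaves room for a strict
   inequality. *)
pose e' := tau * (e ^+ 2 / 2) / (1 + tau).
have tau1 : 0 < 1 + tau by rewrite addr_gt0.
have e'0 : 0 < e' by rewrite divr_gt0// mulr_gt0// divr_gt0// exprn_gt0.
have : \forall k \near \oo, (W12_dist2 tau (v k) v0 < e'%:E)%E.
  by apply: (cv [set x | (x < e'%:E)%E]); apply: open_nbhs_nbhs; split;
    [exact: open_ereal_lt_ereal | rewrite /= lte_fin].
apply: filterS => k We.
have dg t : is_derive t (1 : R) (v k - v0) (F (lam k) (v k t) - F (lam k) (v0 t)).
  exact: is_deriveB (is_sol_derive (solv k) t) (is_sol_derive (sol_v0 (Llam k)) t).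
have cdg i : continuous (fun t => (F (lam k) (v k t) - F (lam k) (v0 t)) i 0).
  have -> : (fun t => (F (lam k) (v k t) - F (lam k) (v0 t)) i 0) =
      (fun t => F (lam k) (v k t) i 0) - (fun t => F (lam k) (v0 t) i 0).
    by apply/funext => t; rewrite mxE [X in _ + X]mxE.
  move=> t; apply: cvgB; first exact: continuous_field (solv k) _.
  exact: continuous_field (sol_v0 (Llam k)) _.
have qle t : sqnorm (v k t - v0 t) <= e ^+ 2 / 2.
  apply: (periodic_le (q := fun t => sqnorm (v k t - v0 t)) tau_gt0) => [s|s s0tau].
    by rewrite (solv k).2 (sol_v0 Lambda_mu).2 -mulmxBr orth_sqnorm.
  have := W12_norm_sup_bound tau_gt0 dg cdg s0tau.
  rewrite (_ : (\int[_]_(_ in _) _)%E = W12_dist2 tau (v k) v0); last first.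
    apply: eq_integral => x _; congr (_ + sqnorm (_ - _))%:E.
      by rewrite ((solv k).1 x).2.
    by rewrite ((sol_v0 (Llam k)).1 x).2.
  move=> Hs; rewrite -(ler_pM2l tau_gt0) -lee_fin (le_trans Hs)//.
  have -> : (tau * (e ^+ 2 / 2))%:E = ((1 + tau)%:E * e'%:E)%E.
    by rewrite -EFinM; congr EFin; rewrite /e' [RHS]mulrC divfK// gt_eqF.
  by apply: lee_wpmul2l; [rewrite lee_fin ltW | exact: ltW].
move=> t; rewrite -(@ltr_pXn2r _ 2)// ?nnegrE// ?ltW//.
rewrite (le_lt_trans (norm_sqr_le_sqnorm _))// (le_lt_trans (qle t))//.
by rewrite ltr_pdivrMr// ltr_pMr ?exprn_gt0// ltr1n.
Qed.

(** * Two solutions of the linearized problem *)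

Lemma velocity_linearized :
  (forall t, is_derive t (1 : R) ('D_1 v0) (A t *m 'D_1 v0 t)) /\
  (forall t, 'D_1 v0 (t + tau) = M *m 'D_1 v0 t).
Proof.
(* The shifts of [v0] by [h k] solve the equation for [mu]; scaling their differences from [v0] by
   [k.+1%:R] gives difference quotients, bounded by the Lipschitz constant. Their limit along [U]
   must be the derivative. *)
pose h k : R := k.+1%:R^-1.
have h0 k : 0 < h k by rewrite invr_gt0 ltr0n.
have ch : h @ \oo --> 0 by exact: cvg_harmonic.
have [L L0 vL] := sol_lipschitz.
have [U [UU ooU]] := ultraFilterLemma (eventually_filter).
have cu e : 0 < e -> \forall k \near \oo, forall t, `|v0 (t + h k) - v0 t| < e.
  move=> e0; have L1 : 0 < L + 1 by rewrite ltr_wpDl.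
  have := ch => /cvgr_dist_lt/(_ _ (divr_gt0 e0 L1)).
  apply: filterS => k; rewrite sub0r normrN ltr_pdivlMr// => hk t.
  rewrite (le_lt_trans (vL _ _))// addrAC subrr add0r mulrC.
  by rewrite (le_lt_trans _ hk)// ler_wpM2l// lerDl.
have nu k : `|k.+1%:R *: (v0 (0 + h k) - v0 0)| <= L.
  rewrite normrZ (le_trans (ler_wpM2l _ (vL _ _)))// add0r subr0.
  by rewrite mulrCA -normrM /h mulfV ?pnatr_eq0// normr1 mulr1.
have [w [dw wA wM]] := linearized_limit (lam := fun=> mu) (fun=> Lambda_mu)
  (cvg_cst _) (fun k => is_sol_shift (h k) (sol_v0 Lambda_mu)) cu nu UU ooU.
suff Dw t : 'D_1 v0 t = w t.
  have -> : 'D_1 v0 = w by apply/funext => t; exact: Dw.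
  by split=> t; rewrite !Dw.
apply: (@cvg_unique _ (@norm_hausdorff _ _)
  (k.+1%:R *: (v0 (t + h k) - v0 t) @[k --> U])); last exact: dw.
have [/cvgrPdist_lt dv _] := is_sol_derive (sol_v0 Lambda_mu) t.
apply/cvgrPdist_lt => e e0.
have /nbhs_ballP[r /= r0 Hr] := dv e e0.
apply: ooU; have := ch => /cvgr_dist_lt/(_ _ r0); apply: filterS => k hk.
have := Hr (h k) hk (lt0r_neq0 (h0 k)).
by rewrite /= [(h k)%:A]mulr1 [t + _]addrC [in (h k)^-1]/h invrK.
Qed.

Lemma transversal_shift (lam : nat -> R) (v : nat -> R -> 'cV[R]_(n + n)) (t0 : R) :
  'D_1 v0 t0 != 0 ->
  (forall k, is_sol H (lam k) tau M (v k)) ->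
  (forall e, 0 < e -> \forall k \near \oo, forall t, `|v k t - v0 t| < e) ->
  forall e, 0 < e -> \forall k \near \oo, exists theta,
    (forall t, `|v k (t + theta) - v0 t| < e) /\
    \sum_i (v k (t0 + theta) - v0 t0) i 0 * 'D_1 v0 t0 i 0 = 0.
Proof.
set y := 'D_1 v0 t0 => y0 solv cv e e0.
(* The component along [y] of the displacement from [v0 t0]. For [v0] it vanishes at 0 with positive
   slope [sqnorm y], so it changes sign there. *)
pose g (u : R -> 'cV[R]_(n + n)) th : R := \sum_i (u (t0 + th) - v0 t0) i 0 * y i 0.
have dg : is_derive (0 : R) (1 : R) (g v0) (sqnorm y).
  have -> : g v0 = \sum_(i < n + n) (fun th => (v0 (t0 + th) - v0 t0) i 0 * y i 0).
    by apply/funext => th; rewrite fct_sumE.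
  apply: is_derive_sum => i.
  have dv : is_derive (0 : R) (1 : R) (fun th => v0 (t0 + th) - v0 t0) y.
    have [dv0 _] := (is_sol_shift t0 (sol_v0 Lambda_mu)).1 0.
    have E : (fun th => v0 (t0 + th)) = (fun th => v0 (th + t0)).
      by apply/funext => th; rewrite addrC.
    have dvs : is_derive (0 : R) (1 : R) (fun th => v0 (t0 + th)) y.
      rewrite E; apply: DeriveDef; first exact: dv0.
      by rewrite ((is_sol_shift t0 (sol_v0 Lambda_mu)).1 0).2 add0r
        -((sol_v0 Lambda_mu).1 t0).2.
    by have := is_deriveB dvs (is_derive_cst (v0 t0) (0 : R) (1 : R)); rewrite subr0.
  have dM := is_deriveM (is_derive_coord i 0 dv) (is_derive_cst (y i 0) (0 : R) (1 : R)).
  apply: (is_derive_eq dM); by rewrite scaler0 add0r expr2.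
have y2 : 0 < sqnorm y.
  rewrite lt_def sqnorm_ge0 andbT; apply: contra y0 => /eqP yy.
  by apply/eqP/sqnorm_eq0; rewrite yy.
have g0 : g v0 0 = 0.
  by rewrite /g big1// => i _; rewrite addr0 subrr mxE mul0r.
have [L L0 vL] := sol_lipschitz.
have L1 : 0 < 2 * (L + 1) by rewrite mulr_gt0// ltr_wpDl.
(* [h] is small enough for the signs at [h] and [- h] to be those of the slope, and for shifts up to
   [h] to move [v0] by less than [e / 2]. *)
have [h h0 [hL gh gNh]] : exists2 h : R, 0 < h &
    [/\ L * h < e / 2, 0 < g v0 h & g v0 (- h) < 0].
  have [dg1 dgE] := dg.
  have : s^-1 *: ((g v0 \o shift 0) (s *: (1 : R)) - g v0 0) @[s --> 0^'] --> sqnorm y.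
    by rewrite -dgE; exact: dg1.
  move=> /cvgrPdist_lt/(_ _ y2)/nbhs_ballP[r /= r0 Hr].
  near (0 : R)^'+ => h; have h0 : 0 < h by [].
  have hr : h < r by near: h; exact: nbhs_right_lt.
  have he : h < e / (2 * (L + 1)) by near: h; apply: nbhs_right_lt; rewrite divr_gt0.
  have q (s : R) : s != 0 -> `|s| < r -> 0 < s^-1 * g v0 s.
    move=> s0 sr.
    have := Hr s _ s0; rewrite /ball/= sub0r normrN => /(_ sr).
    rewrite [s%:A]mulr1 addr0 g0 subr0.
    by rewrite ltr_distlC subrr => /andP[].
  exists h => //; split.
  - rewrite -subr_gt0 (_ : _ - _ = (L + 1) * (e / (2 * (L + 1)) - h) + h).
      by rewrite addr_gt0// mulr_gt0// ?subr_gt0// ltr_wpDl.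
    by field; rewrite gt_eqF// ltr_wpDl.
  - have := q h (lt0r_neq0 h0); rewrite gtr0_norm// => /(_ hr).
    by rewrite pmulr_rgt0// invr_gt0.
  - have := q (- h); rewrite oppr_eq0 normrN gtr0_norm// => /(_ (lt0r_neq0 h0) hr).
    by rewrite nmulr_rgt0// invr_lt0 oppr_lt0.
(* A perturbation of [g] smaller than [m] keeps both signs; [K] converts closeness in the maximum
   norm into closeness of [g]. *)
pose m := Num.min (g v0 h) (- g v0 (- h)).
have m0 : 0 < m by rewrite lt_min gh oppr_gt0.
pose K : R := (n + n)%:R * `|y| + 1.
have K0 : 0 < K by rewrite ltr_wpDl// mulr_ge0.
have := cv _ (divr_gt0 m0 K0); have e2 : 0 < e / 2 by rewrite divr_gt0.
have := cv _ e2; apply: filterS2 => k vke vkm.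
have gd th : `|g (v k) th - g v0 th| < m.
  have -> : g (v k) th - g v0 th = \sum_i (v k (t0 + th) - v0 (t0 + th)) i 0 * y i 0.
    by rewrite /g -sumrB; apply: eq_bigr => i _; rewrite !mxE; ring.
  rewrite (le_lt_trans (ler_norm_sum _ _ _))//.
  rewrite (@le_lt_trans _ _ (\sum_(i < n + n) m / K * `|y|))//.
    apply: ler_sum => i _; rewrite normrM ler_pM// ?coord_le_norm//.
    by rewrite (le_trans (coord_le_norm _ _ _))// ltW.
  rewrite sumr_const card_ord -[ltLHS]mulr_natl mulrCA -mulrA.
  by rewrite gtr_pMr// ltr_pdivrMl// mulr1 /K ltrDl.
have gkh : 0 < g (v k) h.
  have := gd h; rewrite ltr_distl => /andP[+ _]; apply: le_lt_trans.
  by rewrite subr_ge0 ge_min lexx.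
have gkNh : g (v k) (- h) < 0.
  have := gd (- h); rewrite ltr_distl => /andP[_] /lt_le_trans; apply.
  by rewrite -lerBrDl sub0r ge_min lexx orbT.
have cg : continuous (g (v k)).
  move=> th; apply: cvg_sum_real => i; apply: cvgM; last exact: cvg_cst.
  have dv := (is_sol_shift t0 (solv k)).
  have cu : {for th, continuous (fun s => v k (s + t0) i 0)} :=
    derivable_cont (is_derive_coord i 0 (is_sol_derive dv th)).
  have E : (fun s => (v k (t0 + s) - v0 t0) i 0) =
      (fun s => v k (s + t0) i 0) - cst (v0 t0 i 0).
    by apply/funext => s; rewrite mxE [X in _ + X]mxE [t0 + s]addrC.
  have -> := congr1 (fun f => f th) E; rewrite E.
  by apply: cvgB; [exact: cu | exact: cvg_cst].
have Nhh : - h <= h by rewrite ge0_cp// ltW.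
have bd : Num.min (g (v k) (- h)) (g (v k) h) <= 0 <=
    Num.max (g (v k) (- h)) (g (v k) h).
  by rewrite ge_min le_max (ltW gkh) (ltW gkNh) orbT.
have [th] := IVT Nhh (continuous_subspaceT cg) bd.
rewrite in_itv/= -ler_norml => thh gth; exists th; split=> // t.
rewrite -(subrK (v0 (t + th)) (v k (t + th))) -addrA.
rewrite (le_lt_trans (ler_normD _ _))// (splitr e) ltrD//.
rewrite (le_lt_trans (vL _ _))// addrAC subrr add0r.
by rewrite (le_lt_trans _ hL)// ler_wpM2l.
Unshelve. all: by end_near. Qed.

(** Shifted solutions differ from [v0] at [t0] by nonzero vectors orthogonal to the velocity.
    Normalized to norm 1, these vectors have a limit that is still of norm 1 and orthogonal. *)
Lemma transversal_solution (lam : nat -> R) (v : nat -> R -> 'cV[R]_(n + n)) (t0 : R) :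
  'D_1 v0 t0 != 0 ->
  (forall k, Lambda (lam k)) -> lam @ \oo --> mu ->
  (forall k, is_sol H (lam k) tau M (v k)) ->
  (forall k l, k <> l -> R_distinct (v k) (v l)) ->
  (forall e, 0 < e -> \forall k \near \oo, forall t, `|v k t - v0 t| < e) ->
  exists w : R -> 'cV[R]_(n + n),
    [/\ forall t, is_derive t (1 : R) w (A t *m w t),
        forall t, w (t + tau) = M *m w t,
        w t0 != 0 &
        \sum_i w t0 i 0 * 'D_1 v0 t0 i 0 = 0].
Proof.
move=> y0 Llam clam solv vdist cv.
have select (j : nat) : exists kth : nat * R,
    [/\ `|lam kth.1 - mu| < j.+1%:R^-1,
        forall t, `|v kth.1 (t + kth.2) - v0 t| < j.+1%:R^-1,
        \sum_i (v kth.1 (t0 + kth.2) - v0 t0) i 0 * 'D_1 v0 t0 i 0 = 0 &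
        v kth.1 (t0 + kth.2) <> v0 t0].
  near (0 : R)^'+ => r; have r0 : 0 < r by [].
  have rj : r < j.+1%:R^-1 by near: r; apply: nbhs_right_lt; rewrite invr_gt0.
  have runique : forall l u s, Lambda l -> `|l - mu| < r ->
      is_sol H l tau M u -> (forall t, `|u t - v0 t| < r) -> u s = v0 s ->
      forall t, u t = v0 t.
    near: r; exact: sol_unique_near.
  have [N _ HN] : \forall k \near \oo, `|lam k - mu| < r /\ exists th,
      (forall t, `|v k (t + th) - v0 t| < r) /\
      \sum_i (v k (t0 + th) - v0 t0) i 0 * 'D_1 v0 t0 i 0 = 0.
    move/cvgr_distC_lt : clam => /(_ _ r0).
    by apply: filterS2 (transversal_shift y0 solv cv r0).
  (* Of two consecutive indices at least one gives a nonzero difference at [t0]. *)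
  have [lN [th [vth sth]]] := HN N (leqnn N).
  have [lN' [th' [vth' sth']]] := HN N.+1 (leqnSn N).
  have [e1|ne] := pselect (v N (t0 + th) = v0 t0); last first.
    exists (N, th); split=> //=; first exact: lt_trans lN rj.
    by move=> t; exact: lt_trans (vth t) rj.
  have [e2|ne] := pselect (v N.+1 (t0 + th') = v0 t0); last first.
    exists (N.+1, th'); split=> //=; first exact: lt_trans lN' rj.
    by move=> t; exact: lt_trans (vth' t) rj.
  (* If both shifted solutions met [v0] at [t0], both would equal [v0], so each would be a time
     shift of the other. *)
  case: (vdist N N.+1 (n_Sn N)); exists (th' - th) => t.
  have := runique _ _ _ (Llam N) lN (is_sol_shift th (solv N)) vth e1 (t - th).
  rewrite subrK => ->.
  have -> : th' - th + t = t - th + th' by ring.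
  exact/esym/(runique _ _ _ (Llam N.+1) lN' (is_sol_shift th' (solv N.+1)) vth' e2).
have [kth kthP] := choice select.
have near_inv (e : R) : 0 < e -> \forall j \near \oo, j.+1%:R^-1 < e.
  move=> e0; have := @cvg_harmonic R => /cvgr_dist_lt/(_ _ e0).
  by apply: filterS => j; rewrite sub0r normrN ger0_norm// invr_ge0.
have clam' : (fun j => lam (kth j).1) @ \oo --> mu.
  apply/cvgrPdist_lt => e e0; apply: filterS (near_inv e e0) => j je.
  by rewrite distrC (lt_trans _ je)//; case: (kthP j).
have cu e : 0 < e -> \forall j \near \oo, forall t,
    `|v (kth j).1 (t + (kth j).2) - v0 t| < e.
  move=> e0; apply: filterS (near_inv e e0) => j je t.
  by rewrite (lt_trans _ je)//; case: (kthP j).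
pose c j := `|v (kth j).1 (t0 + (kth j).2) - v0 t0|^-1.
have nu j : `|c j *: (v (kth j).1 (t0 + (kth j).2) - v0 t0)| = 1.
  have [_ _ _ /eqP] := kthP j; rewrite -subr_eq0 -normr_eq0 => ne.
  by rewrite normrZ normfV normr_id mulVf.
have nu1 j : `|c j *: (v (kth j).1 (t0 + (kth j).2) - v0 t0)| <= 1 by rewrite nu.
have [U [UU ooU]] := ultraFilterLemma (eventually_filter).
have [w [dw wA wM]] := linearized_limit (fun j => Llam (kth j).1) clam'
  (fun j => is_sol_shift (kth j).2 (solv (kth j).1)) cu nu1 UU ooU.
exists w; split=> //.
  have /cvg_norm := dw t0; under eq_fun do rewrite nu.
  move=> /(cvg_unique (@norm_hausdorff _ _) (cvg_cst _)) w1.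
  by rewrite -normr_eq0 -w1 oner_eq0.
apply/esym; apply: (@cvg_unique _ (@norm_hausdorff _ R^o)
  (\sum_i (c j *: (v (kth j).1 (t0 + (kth j).2) - v0 t0)) i 0 * 'D_1 v0 t0 i 0 @[j --> U])).
  rewrite (_ : (fun j => _) = cst 0); first exact: cvg_cst.
  apply/funext => j; have [_ _ s0 _] := kthP j.
  under eq_bigr do rewrite mxE -mulrA.
  by rewrite -mulr_sumr s0 mulr0.
apply: cvg_sum_real => i; apply: cvgM; last exact: cvg_cst.
exact: (cvg_comp _ _ (dw t0) (@coord_continuous _ _ _ i 0 (w t0))).
Unshelve. all: by end_near. Qed.

End Linearization.

(** * The kernel of the fundamental matrix minus [M], and the conclusion *)

Lemma is_derive_mulmxr (R : realType) p q r (g : R -> 'M[R]_(p, q)) (t : R)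
    (d : 'M[R]_(p, q)) (x : 'M[R]_(q, r)) :
  is_derive t (1 : R) g d ->
  is_derive t (1 : R) (fun s => g s *m x) (d *m x).
Proof.
move=> gd; apply: is_derive_mx => i j.
have -> : (fun s => (g s *m x) i j) = \sum_(k < q) (x k j \*: (fun s => g s i k)).
  apply/funext => s; rewrite mxE fct_sumE; apply: eq_bigr => k _.
  by rewrite mulrC.
rewrite mxE; apply: is_derive_sum => k.
apply: (is_derive_eq (is_deriveZ (x k j) (is_derive_coord i k gd))).
by rewrite [LHS]mulrC.
Qed.

(** [kermx] is a left kernel made of rows; the transposes turn it into the space of columns killed
    by [K]. *)
Lemma rank_kermx_ge2 (F : fieldType) m (K : 'M[F]_m) (x y : 'cV[F]_m) :
  K *m x = 0 -> K *m y = 0 ->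
  (forall a b, a *: x + b *: y = 0 -> a = 0 /\ b = 0) ->
  (2 <= \rank (kermx K^T))%N.
Proof.
move=> Kx Ky xy.
have rf : row_free (col_mx x^T y^T).
  apply: inj_row_free => u; rewrite -[u]hsubmxK mul_row_col.
  rewrite [lsubmx u]mx11_scalar [rsubmx u]mx11_scalar !mul_scalar_mx -!linearZ -linearD.
  move=> /(congr1 trmx); rewrite trmxK trmx0 => /xy[-> ->].
  by rewrite !raddf0 row_mx0.
rewrite -[2%N]/(1 + 1)%N -(eqP rf); apply: mxrankS; apply/sub_kermxP.
by rewrite mul_col_mx -!trmx_mul Kx Ky trmx0 col_mx0.
Qed.

Unset Implicit Arguments.

Theorem theorem5p5 (R : realType) (n : nat) (tau : R) (M : 'M[R]_(n + n))
  (Lambda : set R) (H : R -> 'cV[R]_(n + n) -> R) (v0 : R -> 'cV[R]_(n + n))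
  (mu : R) (lam : nat -> R) (v : nat -> R -> 'cV[R]_(n + n)) :
  0 < tau ->
  symplectic_mx M -> orth_mx M ->
  open Lambda -> is_interval Lambda ->
  {within Lambda `*` setT, continuous (fun p : R * 'cV[R]_(n + n) => H p.1 p.2)} ->
  (forall l, Lambda l -> forall z, H l (M *m z) = H l z) ->
  (forall l, Lambda l -> C2 (H l)) ->
  (forall i : 'I_(n + n),
     {within Lambda `*` setT,
        continuous (fun p : R * 'cV[R]_(n + n) => partial i (H p.1) p.2)}) ->
  (forall i j : 'I_(n + n),
     {within Lambda `*` setT,
        continuous (fun p : R * 'cV[R]_(n + n) => partial j (partial i (H p.1)) p.2)}) ->
  (exists s t, v0 s <> v0 t) ->
  (forall l, Lambda l -> is_sol H l tau M v0) ->
  Lambda mu ->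
  (forall k, Lambda (lam k)) ->
  lam @ \oo --> mu ->
  (forall k, is_sol H (lam k) tau M (v k)) ->
  (forall k l, k <> l -> R_distinct (v k) (v l)) ->
  (fun k => W12_dist2 tau (v k) v0) @ \oo --> 0%E ->
  (exists w1 w2 : R -> 'cV[R]_(n + n),
     (forall w, w = w1 \/ w = w2 ->
        (forall t, derivable w t 1 /\
                   'D_1 w t = Jmat *m hess (H mu) (v0 t) *m w t) /\
        (forall t, w (t + tau) = M *m w t)) /\
     (forall a b : R, (forall t, a *: w1 t + b *: w2 t = 0) -> a = 0 /\ b = 0))
  /\
  (forall gamma : R -> 'M[R]_(n + n),
     (forall t, derivable gamma t 1 /\
                'D_1 gamma t = Jmat *m hess (H mu) (v0 t) *m gamma t) ->
     gamma 0 = 1%:M ->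
     (2 <= \rank (kermx (gamma tau - M)^T))%N).
Proof.
move=> tau0 _ MM oL _ _ _ C2H _ chess [s0 [s1 ns]] solv0 Lmu Llam clam solv vdist cW.
have cv := W12_cvg_uniform tau0 MM Lmu C2H solv0 Llam solv cW.
have [t0 y0] : exists t0, 'D_1 v0 t0 != 0.
  (* A velocity vanishing at all times would make [v0] constant. *)
  apply: contrapT => /forallNP H0; apply: ns; apply: derive_zero_cst => t.
  have [dv _] := (solv0 mu Lmu).1 t; apply: DeriveDef => //.
  by have /negP := H0 t; rewrite negbK => /eqP.
pose w1 : R -> 'cV[R]_(n + n) := 'D_1 v0.
have [dw1 w1M] := velocity_linearized tau0 MM oL Lmu C2H chess solv0.
have [w2 [dw2 w2M w20 w2y]] :=
  transversal_solution tau0 MM oL Lmu C2H chess solv0 y0 Llam clam solv vdist cv.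
(* Independence already holds at the single time [t0]: pairing with [w1 t0] removes the orthogonal
   [w2 t0] and forces [a = 0], and [w2 t0] is nonzero. *)
have indep a b : a *: w1 t0 + b *: w2 t0 = 0 -> a = 0 /\ b = 0.
  move=> E; have a0 : a = 0.
    have : \sum_i (a *: w1 t0 + b *: w2 t0) i 0 * w1 t0 i 0 =
        a * sqnorm (w1 t0) + b * \sum_i w2 t0 i 0 * w1 t0 i 0.
      rewrite !mulr_sumr -big_split/=.
      by apply: eq_bigr => i _; rewrite !mxE; ring.
    rewrite w2y mulr0 addr0 E big1 => [|i _]; last by rewrite mxE mul0r.
    move=> /esym/eqP; rewrite mulf_eq0 => /orP[/eqP//|/eqP yy].
    by case/eqP: y0; apply: sqnorm_eq0; rewrite -/(w1 t0) yy.
  split=> //; move: E; rewrite a0 scale0r add0r => /eqP.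
  by rewrite scaler_eq0 (negbTE w20) orbF => /eqP.
split.
  exists w1, w2; split; last by move=> a b /(_ t0); exact: indep.
  by move=> w [->|->]; split=> // t; split; [have [] := dw1 t|have [_ ->] := dw1 t |
    have [] := dw2 t|have [_ ->] := dw2 t].
move=> gamma dgamma gamma0.
have dg x t : is_derive t (1 : R) (fun s => gamma s *m x)
    (Jmat *m hess (H mu) (v0 t) *m (gamma t *m x)).
  rewrite mulmxA; apply: is_derive_mulmxr.
  by have [? ?] := dgamma t; apply: DeriveDef.
(* By uniqueness [w t] is [gamma t *m w 0]; at [tau] this also equals [M *m w 0]. *)
have Ker (w : R -> 'cV[R]_(n + n)) :
    (forall t, is_derive t (1 : R) w (Jmat *m hess (H mu) (v0 t) *m w t)) ->
    (forall t, w (t + tau) = M *m w t) -> (gamma tau - M) *m w 0 = 0.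
  move=> dw wM; pose p s := gamma s *m w 0 - w s.
  have dp t : is_derive t (1 : R) p (Jmat *m hess (H mu) (v0 t) *m p t).
    by rewrite /p mulmxBr; exact: is_deriveB (dg _ (w 0) t) (dw t).
  have p0 : p 0 = 0 by rewrite /p gamma0 mul1mx subrr.
  have := linear_unique tau0 MM Lmu C2H solv0 dp p0 tau.
  have wtau : w tau = M *m w 0 by rewrite -wM add0r.
  by rewrite /p wtau mulmxBl.
apply: (rank_kermx_ge2 (Ker w1 dw1 w1M) (Ker w2 dw2 w2M)) => a b E.
apply: indep.
(* A combination vanishing at time 0 vanishes identically, hence at [t0], where independence is
   known. *)
pose q s := a *: w1 s + b *: w2 s.
have dq t : is_derive t (1 : R) q (Jmat *m hess (H mu) (v0 t) *m q t).
  rewrite /q mulmxDr -!scalemxAr.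
  exact: is_deriveD (is_deriveZ a (dw1 t)) (is_deriveZ b (dw2 t)).
exact: (linear_unique tau0 MM Lmu C2H solv0 dq E t0).
Qed.
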